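(* Let $n$ be a positive integer that is not divisible by $3$. Then $$C_{3,n}(q,t)=\sum_{i=0}^{\lfloor n/3\rfloor} s_{n-1-2i,i}(q,t),$$ where $C_{3,n}(q,t)=\sum_\pi q^{\mathrm{dinv}(\pi)}t^{\mathrm{area}(\pi)}$ is the sum over all $(3,n)$-Dyck paths $\pi$, and $s_\lambda(q,t)$ denotes the Schur function indexed by the partition $\lambda$ evaluated in the two variables $q,t$.
   Context: Set $m=3$, and let $n$ be a positive integer coprime to $3$. Diagram and paths. The $(m,n)$-lattice is the grid of unit squares (cells) filling the rectangle with southwest corner $(0,0)$ and northeast corner $(m,n)$. Cell $(u,v)$, $1\le u\le m$, $1\le v\le n$, is the unit square whose northeast corner is the point $(u,v)$; it lies in column $u$ and row $v$. Its rank is $\gamma(u,v)=mn-un-(n+1-v)m$ (distinct cells have distinct ranks). An $(m,n)$-Dyck path is a lattice path from $(0,0)$ to $(m,n)$ consisting of unit north and east steps and staying weakly above the diagonal $y=\frac{n}{m}x$. It splits the cells into those above the path (on its northwest side) and those below the path (on its southeast side). Statistics on paths. For a cell $(x,y)$ above $\pi$, $\mathrm{arm}(x,y)$ is the number of cells above $\pi$ in the same row strictly east of $(x,y)$, and $\mathrm{leg}(x,y)$ is the number of cells above $\pi$ in the same column strictly south of $(x,y)$. Then $\mathrm{area}(\pi)$ is the number of cells below $\pi$ with positive rank, and $\mathrm{dinv}(\pi)$ is the number of cells $(x,y)$ above $\pi$ with $\frac{\mathrm{arm}(x,y)}{\mathrm{leg}(x,y)+1}<\frac{m}{n}<\frac{\mathrm{arm}(x,y)+1}{\mathrm{leg}(x,y)}$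 (division by zero is interpreted as $\infty$). *)

(* Defs.v *)
From mathcomp Require Export all_boot all_order all_algebra.
From mathcomp.multinomials Require Export mpoly.

Set Implicit Arguments.
Unset Strict Implicit.
Unset Printing Implicit Defensive.

Import Order.TTheory GRing.Theory Num.Theory.
Local Open Scope ring_scope.

Section DyckPaths.

Variables m n : nat.

(* A lattice path with m + n unit steps starting at (0,0): [true] is a north
   step, [false] an east step. *)
Definition lpath := ((m + n).-tuple bool)%type.

(* The point (xpos p k, ypos p k) is reached after the first k steps. *)
Definition xpos (p : lpath) (k : nat) : nat := count_mem false (take k p).
Definition ypos (p : lpath) (k : nat) : nat := count_mem true (take k p).

(* Ends at (m, n) and all its lattice points satisfy y >= (n / m) x. *)
Definition is_dyck (p : lpath) : bool :=
  [&& xpos p (m + n) == m, ypos p (m + n) == n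
    & [forall k : 'I_(m + n).+1, (n * xpos p k <= m * ypos p k)%N]].

(* Cells are stored with 0-based coordinates; [ccol] and [crow] give the
   1-based coordinates (u, v) of the northeast corner. *)
Definition cell := ('I_m * 'I_n)%type.
Definition ccol (c : cell) : nat := c.1.+1.
Definition crow (c : cell) : nat := c.2.+1.

(* gamma(u, v) = mn - un - (n + 1 - v)m = m(v - 1) - nu: positive iff the
   southeast corner (u, v - 1) is strictly above the diagonal. *)
Definition crank (c : cell) : int :=
  m%:Z * n%:Z - (ccol c)%:Z * n%:Z - (n%:Z + 1 - (crow c)%:Z) * m%:Z.

(* Cell (u, v) is northwest of p iff the north step of p through row v, from
   height v - 1 to v, is taken at an abscissa >= u. *)
Definition above (p : lpath) : {set cell} :=
  [set c | [exists k : 'I_(m + n),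
     [&& tnth p k, (ypos p k).+1 == crow c & (ccol c <= xpos p k)%N]]].

Definition below (p : lpath) : {set cell} := ~: above p.

Definition arm (p : lpath) (c : cell) : nat :=
  #|[set d in above p | (crow d == crow c) && (ccol c < ccol d)%N]|.

Definition leg (p : lpath) (c : cell) : nat :=
  #|[set d in above p | (ccol d == ccol c) && (crow d < crow c)%N]|.

Definition area (p : lpath) : nat := #|[set c in below p | 0 < crank c]|.

(* When leg = 0 the upper bound (arm + 1) / leg is infinite, so the second
   inequality holds. *)
Definition dinv (p : lpath) : nat :=
  #|[set c in above p |
      ((arm p c)%:R / (leg p c).+1%:R < m%:R / n%:R :> rat)
      && ((leg p c == 0%N)
          || (m%:R / n%:R < (arm p c).+1%:R / (leg p c)%:R :> rat))]|.

End DyckPaths.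

Definition qvar : {mpoly int[2]} := 'X_(inord 0).
Definition tvar : {mpoly int[2]} := 'X_(inord 1).

Definition Cqt (m n : nat) : {mpoly int[2]} :=
  \sum_(p : lpath m n | is_dyck p) qvar ^+ dinv p * tvar ^+ area p.

Section Schur.

Variables (N : nat) (sh : seq nat).

(* Boxes (i, j), 0-based, with i < size sh and j < sh_i. *)
Definition box := {i : 'I_(size sh) & 'I_(nth 0%N sh i)}.
Definition brow (b : box) : nat := tag b.
Definition bcol (b : box) : nat := tagged b.

Definition is_ssyt (T : {ffun box -> 'I_N}) : bool :=
  [forall b : box, [forall c : box,
     ((brow b == brow c) && (bcol b < bcol c)%N ==> (T b <= T c)%N)
  && ((bcol b == bcol c) && (brow b < brow c)%N ==> (T b < T c)%N)]].

(* The Schur polynomial in N variables of the partition sh (a weakly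
   decreasing sequence, trailing zeros allowed). *)
Definition schur : {mpoly int[N]} :=
  \sum_(T : {ffun box -> 'I_N} | is_ssyt T) \prod_(b : box) 'X_(T b).

End Schur.

(* Main.v *)
Require Import Defs.
From mathcomp Require Import zify.
Import Order.TTheory GRing.Theory Num.Theory.
Local Open Scope ring_scope.

(** Write k for the quotient of n by 3. A (3, n)-Dyck path is determined by the
    numbers a >= b of cells above it in columns 1 and 2 (column 3 has none), and
    staying above the diagonal means 3a <= 2n and 3b <= n
    ([dyck_path3], [dyck_path3P]). Since n is prime to 3, the rectangle has
    n - 1 cells of positive rank, among them all cells above the path, so the
    area is n - 1 - a - b. In each column the legs of the cells above the path
    run through consecutive integers from 0, and the arms are 0 or 1; counting
    legs in the window imposed by the slope gives
    dinv = b + min(a - b, k + 1) + max(0, a - max(a - b, k))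
    ([area_path3], [dinv_path3]).

    On the other side, a semistandard tableau with two rows l >= i and two
    values has a forced second row, and its first row is given by its number
    i + j of smaller entries, with 0 <= j <= l - i ([schur_two_row]). For
    l = n - 1 - 2i it has weight q^(i+j) t^(n-1-2i-j).

    It remains to match the pairs (a, b) with the pairs (i, j), preserving
    weights. Comparing exponents leaves no choice: i is a + b - dinv and j is
    dinv - i. With d = a - b this reads
    - i = b     and j = a - b            when a <= k,
    - i = k - d and j = 3a - b - 2k      when d <= k < a,
    - i = d - k - 1 and j = 3b + 2k + 2 - a when k < d.
    For fixed i the first family gives the values j = 0, ..., k - i; beyond
    k - i the second gives every j of the parity of i + k and the third every j
    of the other parity, both up to the bound n - 1 - 3i. So each admissible
    (i, j) is hit exactly once ([schur_index_bij], [path_index_bij]). *)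

(** * Counting cells and reindexing sums *)

Lemma sum_interval (n l h : nat) :
  (\sum_(v < n) (l <= v < h) = minn h n - l)%N.
Proof.
elim: n => [|n IH]; first by rewrite big_ord0 minn0 sub0n.
by rewrite big_ord_recr /= IH; lia.
Qed.

Lemma card_cells (m n : nat) (P : pred (cell m n)) :
  #|[set c | P c]| = (\sum_(u < m) \sum_(v < n) P (u, v))%N.
Proof.
rewrite pair_big /= -sum1_card big_mkcond /=.
by apply: eq_bigr => -[u v] _; rewrite inE; case: (P _).
Qed.

Lemma card_cells_interval (m n : nat) (P : pred (cell m n)) (l h : nat -> nat) :
  (forall c, P c = (l c.1 <= c.2 < h c.1)%N) ->
  #|[set c | P c]| = (\sum_(u < m) (minn (h u) n - l u))%N.
Proof.
move=> Pint; rewrite card_cells; apply: eq_bigr => u _.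
by rewrite -sum_interval; apply: eq_bigr => v _; rewrite Pint.
Qed.

(** The change of variables is stated on natural numbers, so that for concrete
    [f] and [g] the hypotheses are plain arithmetic. *)
Lemma sum_nat_pairs_reindex (V : nmodType) (N : nat) (P Q : nat -> nat -> bool)
    (f g : nat -> nat -> nat * nat) (F G : nat -> nat -> V) :
  (forall x y, P x y -> [/\ (x < N)%N, (y < N)%N, Q (f x y).1 (f x y).2 &
     g (f x y).1 (f x y).2 = (x, y)]) ->
  (forall x y, Q x y -> [/\ (x < N)%N, (y < N)%N, P (g x y).1 (g x y).2 &
     f (g x y).1 (g x y).2 = (x, y)]) ->
  (forall x y, P x y -> F x y = G (f x y).1 (f x y).2) ->
  \sum_(u : 'I_N * 'I_N | P u.1 u.2) F u.1 u.2 =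
  \sum_(u : 'I_N * 'I_N | Q u.1 u.2) G u.1 u.2.
Proof.
move=> PQ QP FG.
(* [mk z e] is [e] when it is in range; the pair [z] is only a default. *)
have [mk mkE] : exists mk : 'I_N * 'I_N -> nat * nat -> 'I_N * 'I_N,
    forall z e, (e.1 < N)%N -> (e.2 < N)%N ->
      (mk z e).1 = e.1 :> nat /\ (mk z e).2 = e.2 :> nat.
  exists (fun z e => (insubd z.1 e.1, insubd z.2 e.2)) => z e h1 h2.
  by rewrite /= !val_insubd h1 h2.
have pairE (z w : 'I_N * 'I_N) : w.1 = z.1 :> nat -> w.2 = z.2 :> nat -> w = z.
  by case: z w => [? ?] [? ?] /= /val_inj -> /val_inj ->.
have mk_id (z u : 'I_N * 'I_N) : mk z (u.1 : nat, u.2 : nat) = u.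
  have [e1 e2] := mkE z (u.1 : nat, u.2 : nat) (ltn_ord _) (ltn_ord _).
  exact: pairE.
rewrite (reindex_onto (fun u => mk u (g u.1 u.2))
                      (fun u => mk u (f u.1 u.2))) /=.
  apply: eq_big => [u|u /andP[]].
    apply/idP/idP => [/andP[Pu /eqP uE]|Qu].
      have [_ _ Qf _] := PQ _ _ Pu; have [l1 l2 _ _] := QP _ _ Qf.
      have [e1 e2] := mkE (mk u (g u.1 u.2)) _ l1 l2.
      by move: Qf; rewrite uE in e1 e2; rewrite -e1 -e2.
    have [_ _ Pg fg] := QP _ _ Qu; have [l1 l2 _ _] := PQ _ _ Pg.
    have [e1 e2] := mkE u _ l1 l2; rewrite e1 e2 Pg; apply/eqP.
    by rewrite fg mk_id.
  move=> Pu /eqP uE; rewrite (FG _ _ Pu); have [_ _ Qf _] := PQ _ _ Pu.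
  have [l1 l2 _ _] := QP _ _ Qf.
  have [e1 e2] := mkE (mk u (g u.1 u.2)) _ l1 l2.
  by rewrite uE in e1 e2; rewrite -e1 -e2.
move=> u Pu; have [l1 l2 Qf gf] := PQ _ _ Pu.
have [l3 l4 _ _] := QP _ _ Qf.
by have [e1 e2] := mkE u _ l3 l4; rewrite e1 e2 gf mk_id.
Qed.

Lemma ltr_frac (K : numFieldType) (x y z w : nat) : (0 < y)%N -> (0 < w)%N ->
  (x%:R / y%:R < z%:R / w%:R :> K) = (x * w < z * y)%N.
Proof.
move=> y0 w0; rewrite ltr_pdivrMr ?ltr0n // mulrAC ltr_pdivlMr ?ltr0n //.
by rewrite -!natrM ltr_nat.
Qed.

Lemma div3_bounds (n : nat) : ~~ (3 %| n)%N ->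
  (3 * (n %/ 3) < n < 3 * (n %/ 3) + 3)%N.
Proof.
have := ltn_pmod n (isT : (0 < 3)%N); have := divn_eq n 3; rewrite /dvdn.
move: (n %/ 3)%N (n %% 3)%N => k r; lia.
Qed.

(** * Words of north and east steps *)

(** The abscissa at which the word [s] climbs from height [v] to [v + 1]. *)
Fixpoint xat (s : seq bool) (v : nat) : nat :=
  match s with
  | [::] => 0%N
  | true :: s' => if v is v'.+1 then xat s' v' else 0%N
  | false :: s' => (xat s' v).+1
  end.

Lemma xatP (s : seq bool) (u v : nat) :
  (exists k, [/\ (k < size s)%N, nth false s k,
     count_mem true (take k s) = v & (u <= count_mem false (take k s))%N]) <->
   ((v < count_mem true s)%N && (u <= xat s v)%N).
Proof.
elim: s u v => [|[] s IH] u v.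
- by split=> [[k []]|].
- case: v => [|v] /=.
    split=> [[[|k] []] //=|/= u0].
    by exists 0%N; rewrite take0.
  rewrite add1n ltnS -IH; split=> [[[|k] []] //=|[k [h1 h2 h3 h4]]].
    by rewrite add1n add0n ltnS => h1 h2 [h3] h4; exists k.
  by exists k.+1; rewrite /= h3.
- have -> : (u <= xat (false :: s) v)%N = (u.-1 <= xat s v)%N by case: u.
  rewrite -[count_mem _ _]/(count_mem true s) -IH.
  split=> [[[|k] []] //=|[k [h1 h2 h3 h4]]].
    rewrite add1n add0n ltnS => h1 h2 h3 h4.
    by exists k; split=> //; case: u h4.
  by exists k.+1; rewrite /= h3; split=> //; case: u h4.
Qed.

Lemma in_above (m n : nat) (p : lpath m n) (c : cell m n) :
  count_mem true p = n -> (c \in above p) = (ccol c <= xat p c.2)%N.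
Proof.
move=> pn; rewrite inE.
have := xatP p (ccol c) c.2; rewrite pn ltn_ord /= => pP.
apply/existsP/idP => [[k /and3P[pk /eqP[yk] xk]]|/pP[k [h1 h2 h3 h4]]].
  apply/pP; exists k; split=> //; first by rewrite size_tuple.
  by rewrite -tnth_nth.
rewrite size_tuple in h1; exists (Ordinal h1).
by rewrite (tnth_nth false) h2 /= /crow eqSS -h3 eqxx.
Qed.

Lemma xat_nseq c s v :
  xat (nseq c true ++ s) v = if (v < c)%N then 0%N else xat s (v - c)%N.
Proof. by elim: c v => [|c IH] [|v] //=; rewrite IH ltnS. Qed.

Lemma nseq_false_inj (c d : nat) (s s' : seq bool) :
  nseq c true ++ false :: s = nseq d true ++ false :: s' -> c = d /\ s = s'.
Proof.
by elim: c d => [|c IH] [|d] //= []; [move-> | move/IH=> [-> ->]].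
Qed.

Lemma count_false_split (s : seq bool) (k : nat) :
  count_mem false s = k.+1 ->
  exists c s', s = nseq c true ++ false :: s' /\ count_mem false s' = k.
Proof.
elim: s => [|[] s IH] //= => [/IH[c [s' [-> <-]]]|[<-]].
  by exists c.+1, s'.
by exists 0%N, s.
Qed.

Lemma count_false0 (s : seq bool) :
  count_mem false s = 0%N -> s = nseq (size s) true.
Proof. by elim: s => [|[] s IH] //= /IH {1}->. Qed.

Lemma count_take_cons (x b : bool) (k : nat) (s : seq bool) :
  count_mem b (take k (x :: s)) =
  ((0 < k)%N * (x == b) + count_mem b (take k.-1 s))%N.
Proof. by case: k => [|k] /=; rewrite ?take0 ?mul1n. Qed.

Lemma count_take_nseq (b : bool) (c k : nat) (s : seq bool) :
  count_mem b (take k (nseq c true ++ s)) =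
  (b * minn k c + count_mem b (take (k - c) s))%N.
Proof.
elim: c k => [|c IH] [|k] //=; rewrite ?take0 ?minn0 ?muln0 ?subn0 //.
by rewrite IH subSS minnSS mulnS addnA eq_sym eqb_id.
Qed.

(** * Dyck paths in a rectangle of width 3 *)

(** The path with [a], [b] and 0 cells above it in its three columns. *)
Definition word3 (n a b : nat) : seq bool :=
  nseq (n - a) true ++ false :: nseq (a - b) true ++
    false :: nseq b true ++ [:: false].

Definition fits (n a b : nat) : bool :=
  [&& b <= a, 3 * a <= 2 * n & 3 * b <= n]%N.

Lemma fits_ltn n a b : (0 < n)%N -> fits n a b -> (a < n)%N.
Proof. by rewrite /fits; lia. Qed.

Lemma fits_leq n a b : fits n a b -> (b <= a <= n)%N.
Proof. by rewrite /fits; lia. Qed.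

Lemma size_word3 n a b : (b <= a <= n)%N -> size (word3 n a b) = (3 + n)%N.
Proof.
rewrite /word3 !(size_cat, size_nseq) /= !(size_cat, size_nseq) /=.
by rewrite size_cat size_nseq /=; lia.
Qed.

Lemma count_word3 n a b : (b <= a <= n)%N -> count_mem true (word3 n a b) = n.
Proof.
rewrite /word3 !(count_cat, count_nseq) /= !(count_cat, count_nseq) /=.
by rewrite count_cat count_nseq /=; lia.
Qed.

Lemma xat_word3 n a b v : (b <= a <= n)%N -> (v < n)%N ->
  xat (word3 n a b) v = ((n - a <= v) + (n - b <= v))%N.
Proof.
move=> h1 h2; rewrite /word3 xat_nseq /= xat_nseq /= xat_nseq /=.
by do 3?case: ifP; lia.
Qed.

(** [insubd] makes the word a tuple without carrying a proof of its length,
    which is 3 + n as soon as [b <= a <= n]. *)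
Definition path3 (n a b : nat) : lpath 3 n :=
  insubd (nseq_tuple (3 + n) true) (word3 n a b).

(** The height of the path over column [u], counted from 0; the default value
    [n] of [nth] is the right one for the last column. *)
Definition base (n a b u : nat) : nat := nth n [:: n - a; n - b]%N u.

Section Path3.
Variables (n a b : nat).
Hypothesis fit : fits n a b.

Lemma val_path3 : path3 n a b = word3 n a b :> seq bool.
Proof. by rewrite val_insubd size_word3 ?fits_leq ?eqxx. Qed.

Lemma dyck_path3 : is_dyck (path3 n a b).
Proof.
have le := fits_leq _ _ _ fit.
rewrite /is_dyck /xpos /ypos val_path3 !take_oversize ?size_word3 //.
rewrite count_word3 // eqxx andTb.
move: fit; rewrite /fits => /and3P[h1 h2 h3].
apply/andP; split.
  rewrite /word3 !(count_cat, count_nseq) /= !(count_cat, count_nseq) /=.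
  by rewrite count_cat count_nseq.
apply/forallP => k; rewrite /word3.
rewrite !(count_take_nseq, count_take_cons) /=.
case: k => k /= hk.
(* Splitting on which east steps are among the first k makes the goal linear. *)
by do 3!(case: (ltnP 0 _) => ? //=); rewrite ?mul0n ?mul1n /=; lia.
Qed.

Lemma above_path3 (c : cell 3 n) :
  (c \in above (path3 n a b)) = (base n a b c.1 <= c.2)%N.
Proof.
have [le1 le2] := (fits_leq _ _ _ fit, ltn_ord c.2).
rewrite in_above val_path3 ?count_word3 // xat_word3 // /ccol /base.
by case: c le2 => [[[|[|[|u]]] hu] v] //= le2; lia.
Qed.

Lemma leg_path3 (c : cell 3 n) :
  leg (path3 n a b) c = (c.2 - base n a b c.1)%N.
Proof.
rewrite /leg (@card_cells_interval _ _ _ (base n a b)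
  (fun u => if u == c.1 :> nat then c.2 : nat else 0%N)).
  rewrite (bigD1 c.1) //= eqxx big1 ?addn0.
    by rewrite (minn_idPl (ltnW _)).
  by move=> u /negPf; rewrite -val_eqE /= => ->; rewrite min0n.
move=> d; rewrite above_path3 /ccol /crow eqSS ltnS.
by case: eqP => /=; rewrite ?andbT ?ltn0 ?andbF.
Qed.

Lemma arm_path3 (c : cell 3 n) :
  arm (path3 n a b) c = ((c.1 == 0 :> nat) && (n - b <= c.2))%N.
Proof.
have [le1 le2] := (fits_leq _ _ _ fit, ltn_ord c.2).
rewrite /arm (@card_cells_interval _ _ _ (fun=> c.2 : nat) (fun u =>
  if (c.1 < u)%N && (base n a b u <= c.2)%N then c.2.+1 else 0%N)).
  rewrite !big_ord_recl big_ord0 /= /base /bump /=.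
  by case: c le2 => [[[|[|[|u]]] hu] v] //= le2; do ?case: ifP; lia.
move=> d; rewrite above_path3 /ccol /crow eqSS ltnS.
by case: ifP; rewrite ?ltn0 ?andbF; lia.
Qed.

Lemma crank_gt0 (m N : nat) (c : cell m N) :
  (0 < crank c) = (ccol c * N < m * c.2)%N.
Proof.
have -> : crank c = (m * c.2)%N%:Z - (ccol c * N)%N%:Z.
  by rewrite /crank /crow; lia.
by rewrite subr_gt0 ltz_nat.
Qed.

Lemma area_path3 (ndiv : ~~ (3 %| n)%N) :
  area (path3 n a b) = (n - 1 - a - b)%N.
Proof.
(* The cell with 0-based coordinates (u, v) has positive rank iff 3v exceeds
   (u + 1)n, that is iff v exceeds the quotient of (u + 1)n by 3. *)
rewrite /area (@card_cells_interval _ _ _ (fun u => (u.+1 * n %/ 3).+1)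
  (base n a b)); last first.
  move=> c; rewrite /below inE above_path3 -ltnNge crank_gt0 [(3 * _)%N]mulnC.
  by rewrite -ltn_divLR // andbC.
rewrite !big_ord_recl big_ord0 /= /base /bump /= mulKn // minnn.
rewrite mul1n mulnC (minn_idPl (leq_subr _ _)) (minn_idPl (leq_subr _ _)).
have e2 : (n * 2 %/ 3 = n - (n %/ 3).+1)%N.
  have := div3_bounds n ndiv; move: (n %/ 3)%N => k bounds.
  apply/eqP; rewrite eqn_leq -ltnS ltn_divLR // leq_divRL //.
  by move: bounds; clear; lia.
rewrite e2; have := div3_bounds n ndiv; move: (n %/ 3)%N => k bounds.
by move: fit bounds; rewrite /fits; clear; lia.
Qed.

(** For a cell of arm 0 the two inequalities say leg <= k, and for a cell of
    arm 1 they say leg >= k, the bound 3 leg < 2n being automatic. The arm is 1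
    exactly for the cells of column 1 in the [b] top rows, so the cells counted
    in column 1 form two disjoint intervals; in column 2 all legs are less than
    [b <= k], and every cell counts. *)
Lemma dinv_path3 (ndiv : ~~ (3 %| n)%N) :
  dinv (path3 n a b) =
  (b + minn (a - b) (n %/ 3).+1 + (a - maxn (a - b) (n %/ 3)))%N.
Proof.
have n0 : (0 < n)%N by case: n ndiv.
have := div3_bounds n ndiv; move: (n %/ 3)%N => k bounds.
have legle l : (3 * l < n)%N = (l <= k)%N by move: bounds; clear; lia.
have leggt l : (n < 3 * l.+1)%N = (k <= l)%N by move: bounds; clear; lia.
move: fit; rewrite /fits => /and3P[h1 h2 h3].
transitivity (\sum_(u < 3) \sum_(v < n)
   ((base n a b u <= v < if u == 0 :> nat
       then minn (n - b) (n - a + k.+1) else n) +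
    ((if u == 0 :> nat then maxn (n - b) (n - a + k) else n) <= v < n)))%N.
  rewrite /dinv card_cells; apply: eq_bigr => u _; apply: eq_bigr => v _.
  have lv := ltn_ord v.
  rewrite above_path3 arm_path3 leg_path3 ltr_frac //=.
  have -> : ((v - base n a b u)%N == 0%N) ||
      (3%:R / n%:R < ((u == 0 :> nat) && (n - b <= v)%N).+1%:R
                       / (v - base n a b u)%:R :> rat)
    = (3 * (v - base n a b u) < ((u == 0 :> nat) && (n - b <= v)).+1 * n)%N.
    case: (posnP (v - base n a b u)) => [->|l0].
      by rewrite muln0 muln_gt0 n0.
    by rewrite ltr_frac //; case: eqP l0 => // ->.
  rewrite lv andbT.
  case: u => [[|[|[|u]]] hu] //=; rewrite /base /=; last first.
  - by rewrite leqNgt lv.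
  - rewrite mul1n legle lv (leqNgt n v) lv andbT addn0.
    by case: leqP => //= xv; move: h3 lv bounds; clear; lia.
  (* In column 1, with l the leg, the arm is 1 iff [a - b <= l]. *)
  have -> : (n - b = n - a + (a - b))%N by move: h1 h2; clear; lia.
  have [xv|xv] := leqP (n - a) v; last first.
    by rewrite geq_max [(_ + (a - b) <= v)%N]leqNgt (leq_trans xv) ?leq_addr.
  have : (v - (n - a) < a)%N by move: lv xv; clear; lia.
  move: xv => /subnKC <-; rewrite addKn; move: (v - (n - a))%N => l la.
  rewrite geq_max leq_min !ltn_add2l !leq_add2l ltnS.
  case: (leqP (a - b) l) => dl; rewrite ?mul1n ?mul0n ?leggt ?legle ?addn0 //.
  have -> : (3 * l < 2 * n)%N by move: h2 la; clear; lia.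
  by rewrite andbT.
rewrite !big_ord_recl big_ord0 !big_split /= !sum_interval /base /=.
have an : (a <= n)%N by move: h2; clear; lia.
have -> : (n - b = n - a + (a - b))%N by move: h1 an; clear; lia.
rewrite -addn_minr -addn_maxr.
have le : (n - a + minn (a - b) k.+1 <= n)%N.
  by rewrite -[X in (_ <= X)%N](subnK an) leq_add2l geq_min leq_subr.
rewrite (minn_idPl le) !minnn !subnn !addn0 addKn !subnDA !(subKn an).
by rewrite (subKn h1) addnC addnA.
Qed.
End Path3.

Lemma dyck_path3P (n : nat) (p : lpath 3 n) :
  is_dyck p -> exists a b, fits n a b /\ p = path3 n a b.
Proof.
rewrite /is_dyck /xpos /ypos !take_oversize ?size_tuple //.
case/and3P => /eqP c3 /eqP cn /forallP dyck.
have [c0 [s1 [ps /count_false_split[c1 [s2 [s1s]]]]]] :=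
  count_false_split _ _ c3.
case/count_false_split => [c2 [s4 [s2s /count_false0]]].
set c4 := size s4 => s4s.
(* The empty last word lets the counting lemmas apply to the last block. *)
have ps' : val p = nseq c0 true ++ false :: nseq c1 true ++
    false :: nseq c2 true ++ false :: nseq c4 true ++ [::].
  by rewrite cats0 -s4s -s2s -s1s.
have sum : (c0 + c1 + c2 + c4 = n)%N.
  by rewrite -cn ps'; do 4!rewrite !(count_cat, count_nseq) /=; lia.
have D k : (k < (3 + n).+1)%N ->
    (n * count_mem false (take k p) <= 3 * count_mem true (take k p))%N.
  by move=> hk; apply: (dyck (Ordinal hk)).
(* The path condition just after each of the three east steps. *)
have c40 : c4 = 0%N.
  have := D (c0 + c1 + c2 + 3)%N.
  rewrite ps' !(count_take_nseq, count_take_cons) /= => /(_ ltac:(lia)).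
  by do 3!(rewrite (_ : (0 < _)%N = true); last lia); rewrite /=; lia.
have h1 : (n <= 3 * c0)%N.
  have := D (c0 + 1)%N.
  rewrite ps' !(count_take_nseq, count_take_cons) /= => /(_ ltac:(lia)).
  by rewrite (_ : (0 < _)%N = true); last lia; rewrite /=; lia.
have h2 : (2 * n <= 3 * (c0 + c1))%N.
  have := D (c0 + c1 + 2)%N.
  rewrite ps' !(count_take_nseq, count_take_cons) /= => /(_ ltac:(lia)).
  by do 2!(rewrite (_ : (0 < _)%N = true); last lia); rewrite /=; lia.
have fit : fits n (c1 + c2) c2 by rewrite /fits; lia.
exists (c1 + c2)%N, c2; split=> //; apply: val_inj; rewrite /= val_path3 //.
by rewrite ps' c40 /word3 addnK; congr (nseq _ true ++ _); lia.
Qed.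

Lemma path3_inj (n a b a' b' : nat) : fits n a b -> fits n a' b' ->
  path3 n a b = path3 n a' b' -> a = a' /\ b = b'.
Proof.
move=> f f' /(congr1 val); rewrite /= !val_path3 //.
case/nseq_false_inj => ea /nseq_false_inj[eb _].
by move: f f' ea eb; rewrite /fits; lia.
Qed.

Lemma Cqt3_pairs (n : nat) : (0 < n)%N -> Cqt 3 n =
  \sum_(u : 'I_n * 'I_n | fits n u.1 u.2)
    qvar ^+ dinv (path3 n u.1 u.2) * tvar ^+ area (path3 n u.1 u.2).
Proof.
move=> n0; pose h (u : 'I_n * 'I_n) := path3 n u.1 u.2.
have -> : Cqt 3 n = \sum_(p in h @: [set u : 'I_n * 'I_n | fits n u.1 u.2])
    qvar ^+ dinv p * tvar ^+ area p.
  apply: eq_bigl => p; apply/idP/imsetP => [/dyck_path3P[a [b [f ->]]]|[u]].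
    have lta := fits_ltn _ _ _ n0 f; have le := fits_leq _ _ _ f.
    have ltb : (b < n)%N by lia.
    by exists (Ordinal lta, Ordinal ltb); rewrite ?inE.
  by rewrite inE => /dyck_path3 f ->.
rewrite big_imset /=; first by apply: eq_bigl => u; rewrite inE.
case=> [a b] [a' b']; rewrite !inE => f f'.
move=> /(path3_inj _ _ _ _ _ f f') /= [ea eb].
by congr pair; apply: val_inj.
Qed.

(** * Two-row Schur polynomials in two variables *)

Section Schur2.
Variables (l i : nat).
Hypothesis le_il : (i <= l)%N.

Definition box_top (c : 'I_l) : box [:: l; i] :=
  @Tagged 'I_2 ord0 (fun r => 'I_(nth 0%N [:: l; i] r)) c.
Definition box_bot (c : 'I_i) : box [:: l; i] :=
  @Tagged 'I_2 (lift ord0 ord0) (fun r => 'I_(nth 0%N [:: l; i] r)) c.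

Lemma boxP (b : box [:: l; i]) :
  (exists c, b = box_top c) \/ (exists c, b = box_bot c).
Proof.
case: b => r c.
have [e|e] : r = ord0 \/ r = lift ord0 ord0.
  by case: (unliftP ord0 r) => [r' ->|->]; [right; rewrite (ord1 r')|left].
  by subst r; left; exists c.
by subst r; right; exists c.
Qed.

Lemma big_box (R : comPzRingType) (F : box [:: l; i] -> R) :
  \prod_b F b = (\prod_(c < l) F (box_top c)) * \prod_(c < i) F (box_bot c).
Proof.
transitivity (\prod_(r : 'I_2) \prod_(c : 'I_(nth 0%N [:: l; i] r))
    F (@Tagged 'I_2 r (fun r => 'I_(nth 0%N [:: l; i] r)) c)).
  by rewrite sig_big_dep /=; apply: eq_big => // -[].
by rewrite big_ord_recl big_ord_recl big_ord0 mulr1.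
Qed.

(** A set of indices closed downwards is an initial segment, hence known from
    its cardinality: if [P c] then [P] holds at 0, ..., c, and otherwise only
    below c. *)
Lemma prefix_pred (P : pred 'I_l) :
  (forall c d : 'I_l, (c <= d)%N -> P d -> P c) ->
  forall c, P c = (c < \sum_(d < l) P d)%N.
Proof.
move=> mono c; have lc := ltn_ord c; case: (boolP (P c)) => Pc; symmetry.
  have <- : (\sum_(d < l) (0 <= d < c.+1) = c.+1)%N.
    by rewrite sum_interval; lia.
  apply: leq_sum => d _; rewrite /= ltnS.
  by case: (leqP d c) => // dc; rewrite (mono _ _ dc Pc).
apply: negbTE; rewrite -leqNgt.
have sumc : (\sum_(d < l) (0 <= d < c) = c)%N by rewrite sum_interval; lia.
rewrite -[X in (_ <= X)%N]sumc; apply: leq_sum => d _ /=.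
case: (ltnP d c) => // cd; first by case: (P d).
by rewrite (negbTE (contra (mono _ _ cd) Pc)).
Qed.

Definition two_row_tab (k : nat) : {ffun box [:: l; i] -> 'I_2} :=
  [ffun b => inord ((0 < brow b) || (k <= bcol b))]%N.

Definition top_zeros (T : {ffun box [:: l; i] -> 'I_2}) : nat :=
  (\sum_(c < l) (T (box_top c) == 0%N :> nat))%N.

Lemma two_row_tab_val k b :
  two_row_tab k b = ((0 < brow b)%N || (k <= bcol b)%N) :> nat.
Proof. by rewrite ffunE inordK //; case: (_ || _). Qed.

(** Columns increase strictly because every box above the second row, of
    length [i <= k], holds a 0. *)
Lemma two_row_tab_ssyt k : (i <= k)%N -> is_ssyt (two_row_tab k).
Proof.
move=> ik; apply/forallP => b; apply/forallP => c; rewrite !two_row_tab_val.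
have bot_short : (0 < brow c)%N -> (bcol c < i)%N.
  by case: (boxP c) => -[d ->] // _; apply: ltn_ord.
have : (brow c < 2)%N by rewrite /brow.
by lia.
Qed.

Lemma top_zeros_tab k : (k <= l)%N -> top_zeros (two_row_tab k) = k.
Proof.
move=> kl; transitivity (\sum_(c < l) (0 <= c < k))%N.
  by apply: eq_bigr => c _; rewrite two_row_tab_val /=; case: leqP.
by rewrite sum_interval; lia.
Qed.

Lemma ssyt_two_row T : is_ssyt T ->
  (i <= top_zeros T <= l)%N /\ T = two_row_tab (top_zeros T).
Proof.
move=> /forallP ssT.
have row b c : brow b = brow c -> (bcol b < bcol c)%N -> (T b <= T c)%N.
  move=> e1 e2; have /forallP/(_ c)/andP[/implyP H _] := ssT b.
  by apply: H; rewrite e1 eqxx e2.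
have col b c : bcol b = bcol c -> (brow b < brow c)%N -> (T b < T c)%N.
  move=> e1 e2; have /forallP/(_ c)/andP[_ /implyP H] := ssT b.
  by apply: H; rewrite e1 eqxx e2.
have topE : forall c, (T (box_top c) == 0%N :> nat) = (c < top_zeros T)%N.
  apply: (prefix_pred (fun c => T (box_top c) == 0%N :> nat)) => c d.
  rewrite leq_eqVlt => /orP[/eqP/val_inj->//|cd] /eqP Td.
  by have := row (box_top c) (box_top d) erefl cd; rewrite Td leqn0.
have vert (c : 'I_i) : T (box_top (widen_ord le_il c)) = 0%N :> nat /\
    T (box_bot c) = 1%N :> nat.
  have := col (box_top (widen_ord le_il c)) (box_bot c) erefl erefl.
  by have := ltn_ord (T (box_bot c)); lia.
split.
  apply/andP; split; last first.
    rewrite /top_zeros -[X in (_ <= X)%N]card_ord -sum1_card.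
    by apply: leq_sum => c _; case: (_ == _).
  case: (posnP i) => [->//|i0].
  have lt : (i.-1 < i)%N by rewrite prednK.
  have [/eqP top0 _] := vert (Ordinal lt).
  by move: top0; rewrite topE /= prednK.
apply/ffunP => b; apply: val_inj; rewrite /= two_row_tab_val.
case: (boxP b) => -[c ->] /=; last by case: (vert c) => _ ->.
by rewrite leqNgt -topE; case: (T _) => -[|[|x]].
Qed.

Lemma prod_threshold k : (k <= l)%N ->
  \prod_(c < l) ('X_(inord (k <= c)%N) : {mpoly int[2]}) =
  qvar ^+ k * tvar ^+ (l - k).
Proof.
move=> kl; rewrite -(subnKC kl) big_split_ord /= subnKC //; congr (_ * _).
  rewrite -[k in RHS]card_ord -prodr_const; apply: eq_bigr => c _.
  by rewrite leqNgt ltn_ord.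
rewrite -[X in _ ^+ X]card_ord -prodr_const; apply: eq_bigr => c _.
by rewrite leq_addr.
Qed.

Lemma schur_two_row :
  schur 2 [:: l; i] =
  \sum_(j < (l - i).+1) qvar ^+ (i + j) * tvar ^+ (l - j).
Proof.
rewrite /schur (reindex_onto (fun j : 'I_(l - i).+1 => two_row_tab (i + j))
   (fun T => inord (top_zeros T - i))) /=; last first.
  move=> T /ssyt_two_row[le {2}->]; rewrite inordK; last lia.
  by congr two_row_tab; lia.
apply: eq_big => [j|j _]; have lj := ltn_ord j.
  rewrite two_row_tab_ssyt ?leq_addr // top_zeros_tab; last lia.
  by rewrite addKn inord_val eqxx.
rewrite big_box.
have -> : \prod_(c < i) 'X_(two_row_tab (i + j) (box_bot c)) = tvar ^+ i.
  rewrite -[i in RHS]card_ord -prodr_const; apply: eq_bigr => c _.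
  by rewrite ffunE.
rewrite (eq_bigr (fun c : 'I_l => 'X_(inord (i + j <= c)%N))).
  rewrite prod_threshold; last lia.
  by rewrite -mulrA -exprD; congr (_ * _ ^+ _); lia.
by move=> c _; rewrite ffunE.
Qed.
End Schur2.

(** * Matching paths with tableaux *)

Definition is_schur_index (n i j : nat) : bool :=
  ((i < (n %/ 3).+1) && (j < (n - 1 - 2 * i - i).+1))%N.

Definition schur_index (n a b : nat) : nat * nat :=
  let k := (n %/ 3)%N in
  if (k < a - b)%N then (a - b - k - 1, 3 * b + 2 * k + 2 - a)%N
  else if (a <= k)%N then (b, a - b)%N
  else (k - (a - b), 3 * a - b - 2 * k)%N.

(** Beyond [k - i], the parity of [i + j + k] tells which of the two equations
    [i = k - d] and [i = d - k - 1] determines [d = a - b]. *)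
Definition path_index (n i j : nat) : nat * nat :=
  let k := (n %/ 3)%N in
  if (i + j <= k)%N then (i + j, i)%N
  else if odd (i + j + k) then
    let b := (i + j - k)./2 in (b + (i + k).+1, b)%N
  else let a := (i + j + k)./2 in (a, a - (k - i))%N.

Section Matching.
Variable n : nat.
Hypothesis ndiv : ~~ (3 %| n)%N.

Lemma schur_index_bij a b (e := schur_index n a b) : fits n a b ->
  [/\ (a < n)%N, (b < n)%N, is_schur_index n e.1 e.2 &
      path_index n e.1 e.2 = (a, b)].
Proof.
rewrite {}/e /fits /is_schur_index /schur_index /path_index.
have := div3_bounds n ndiv; move: (n %/ 3)%N => k /andP[k1 k2].
move=> /and3P[/subnKC]; move: (a - b)%N => d <- {a} a2 b2.
have [d0|d0] := ltnP k d.
  (* i + j + k = 2(b + k) + 1: the odd case of [path_index]. *)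
  move: d0 a2 => /subnKC; move: (d - k.+1)%N => i <- {d} a2.
  have -> : (k.+1 + i - k - 1 = i)%N by lia.
  have ij : (i <= 2 * b + k.+1)%N by lia.
  have -> : (3 * b + 2 * k + 2 - (b + (k.+1 + i)) = 2 * b + k.+1 - i)%N by lia.
  move: ij => /subnKC; move: (2 * b + k.+1 - i)%N => j ij /=.
  have gt : (i + j <= k)%N = false by lia.
  rewrite gt ij.
  have -> : odd (2 * b + k.+1 + k) by lia.
  have -> : ((2 * b + k.+1 - k)./2 = b)%N by lia.
  split; [lia|lia|lia|congr pair; lia].
have [d1|d1] := leqP (b + d) k.
  rewrite /= d1; split=> //; lia.
(* i + j + k = 2a: the even case of [path_index]. *)
move: d0 a2 d1 => /subnKC; move: (k - d)%N => i dk; subst k => a2 d1 /=.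
have -> : (3 * (b + d) - b - 2 * (d + i) = 2 * b + d - 2 * i)%N by lia.
have ib : (i < b)%N by lia.
have : (i <= 2 * b + d - i)%N by lia.
have -> : (2 * b + d - 2 * i = 2 * b + d - i - i)%N by lia.
move=> /subnKC; move: (2 * b + d - i - i)%N => j ij.
have ijE : (i + j = 2 * b + d - i)%N by lia.
have gt : (i + j <= d + i)%N = false by lia.
have e : (i + j + (d + i) = 2 * (b + d))%N by lia.
rewrite gt e (mul2n (b + d)) odd_double doubleK.
split; [lia|lia|lia|congr pair; lia].
Qed.

Lemma path_index_bij i j (e := path_index n i j) : is_schur_index n i j ->
  [/\ (i < n)%N, (j < n)%N, fits n e.1 e.2 & schur_index n e.1 e.2 = (i, j)].
Proof.
rewrite {}/e /fits /is_schur_index /schur_index /path_index.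
have := div3_bounds n ndiv; move: (n %/ 3)%N => k /andP[k1 k2].
rewrite !ltnS -!subnDA => /andP[ik jn].
have [small|big] := leqP (i + j) k.
  have -> /= : (k < i + j - i)%N = false by lia.
  by rewrite small addKn; split=> //; lia.
have := odd_double_half (i + j + k); rewrite -mul2n.
case: (odd _); rewrite ?add0n ?add1n => par /=.
  have -> : ((i + j - k)./2 = (i + j + k)./2 - k)%N by lia.
  move: ((i + j + k)./2)%N par => h par.
  have [b hb] : exists b, h = (b + k)%N by exists (h - k)%N; lia.
  subst h; rewrite addnK addKn.
  have -> : (k < (i + k).+1)%N by lia.
  split; [lia|lia|lia|congr pair; lia].
move: ((i + j + k)./2)%N par => h par.
have -> : (h - (h - (k - i)) = k - i)%N by lia.
have -> /= : (k < k - i)%N = false by lia.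
have -> /= : (h <= k)%N = false by lia.
split; [lia|lia|lia|congr pair; lia].
Qed.

(** With d = a - b, dinv is 2b + k + 1, a, or 2a - k according to the three
    cases k < d, a <= k, and d <= k < a. *)
Lemma schur_index_weight a b (e := schur_index n a b) : fits n a b ->
  dinv (path3 n a b) = (e.1 + e.2)%N /\
  area (path3 n a b) = (n - 1 - 2 * e.1 - e.2)%N.
Proof.
rewrite {}/e => f; rewrite dinv_path3 // area_path3 //.
move: f; rewrite /fits /schur_index.
have := div3_bounds n ndiv; move: (n %/ 3)%N => k /andP[k1 k2].
move=> /and3P[/subnKC]; move: (a - b)%N => d <- {a} a2 b2.
have [d0|d0] /= := ltnP k d.
  rewrite (minn_idPr d0).
  by move: d0 a2 b2 k1 k2; clear; split; lia.
rewrite (minn_idPl (leqW d0)).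
by move: d0 a2 b2 k1 k2; clear; case: (leqP (b + d) k) => /=; split; lia.
Qed.
End Matching.

Theorem corollary3 (n : nat) (n_gt0 : (0 < n)%N) (n_ndiv3 : ~~ (3 %| n)%N) :
  Cqt 3 n =
  \sum_(0 <= i < (n %/ 3).+1) schur 2 [:: (n - 1 - 2 * i)%N; i].
Proof.
pose G i j : {mpoly int[2]} := qvar ^+ (i + j) * tvar ^+ (n - 1 - 2 * i - j).
transitivity (\sum_(u : 'I_n * 'I_n | is_schur_index n u.1 u.2) G u.1 u.2).
  rewrite Cqt3_pairs //.
  apply: (sum_nat_pairs_reindex _ _ (fits n) (is_schur_index n)
    (schur_index n) (path_index n)
    (fun a b => qvar ^+ dinv (path3 n a b) * tvar ^+ area (path3 n a b)) G).
  - exact: schur_index_bij.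
  - exact: path_index_bij.
  - by move=> a b /schur_index_weight[//|-> ->].
rewrite big_mkord.
rewrite (big_ord_widen n (fun i => schur 2 [:: (n - 1 - 2 * i)%N; i]));
  last lia.
rewrite -(pair_big_dep (fun i : 'I_n => (i < (n %/ 3).+1)%N)
  (fun i j : 'I_n => (j < (n - 1 - 2 * i - i).+1)%N) (fun i j : 'I_n => G i j)).
apply: eq_bigr => i lei; rewrite schur_two_row; last lia.
by rewrite (big_ord_widen n (G i)) //; lia.
Qed.
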